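(* Let $A$ be an Artin algebra with ADR algebra $R=R_A=\operatorname{End}_A(G)^{op}$, and let $M$ be a (finitely generated left) $A$-module. The socle series of $M$ induces the $\Delta$-semisimple filtration of the $R$-module $\operatorname{Hom}_A(G,M)$: for all integers $m\geq 0$, \[ \delta_m\big(\operatorname{Hom}_A(G,M)\big)=\operatorname{Hom}_A(G,\operatorname{Soc}_mM). \] In particular, the $\Delta$-semisimple length of $\operatorname{Hom}_A(G,M)$ equals the Loewy length of $M$, i.e. $\operatorname{\Delta.ssl}(\operatorname{Hom}_A(G,M))=\operatorname{LL}(M)$.
   Context: All modules are finitely generated left modules. Let $A$ be an Artin algebra, $\{P_1,\dots,P_n\}$ a complete set of pairwise non-isomorphic projective indecomposable $A$-modules, and $l_i$ the Loewy length of $P_i$. Put $G=\bigoplus_{i=1}^n\bigoplus_{j=1}^{l_i}P_i/\operatorname{Rad}^jP_i$. The ADR algebra of $A$ is $R=R_A=\operatorname{End}_A(G)^{op}$; for an $A$-module $M$, $\operatorname{Hom}_A(G,M)$ is a left $R$-module. The projective indecomposable $R$-modules are $P_{i,j}=\operatorname{Hom}_A(G,P_i/\operatorname{Rad}^jP_i)$, for $(i,j)\in\Lambda=\{(i,j):1\leq i\leq n,\ 1\leq j\leq l_i\}$. Let $L_{i,j}$ be the simple top of $P_{i,j}$. The set $\Lambda$ is partially ordered by $(i,j)\lhd(k,l)\Leftrightarrow j>l$ (so $(i,j)\unlhd(k,l)$ means $(i,j)=(k,l)$ or $j>l$). The trace $\operatorname{Tr}(X,M)$ of a module (or class of modules)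 $X$ in $M$ is the sum of the images of all homomorphisms to $M$ from $X$ (or from members of $X$). The standard $R$-modules are $\Delta(i,j)=P_{i,j}/\operatorname{Tr}\big(\bigoplus_{(k,l)\not\unlhd(i,j)}P_{k,l},P_{i,j}\big)$. $\mathcal{F}(\Delta)$ is the class of $R$-modules having a filtration whose factors are standard modules; it is known that $\operatorname{Hom}_A(G,M)\in\mathcal{F}(\Delta)$ for every $A$-module $M$. For an $R$-module $N$ put $\delta(N)=\operatorname{Tr}(\Delta,N)$, where $\Delta$ is the set of standard $R$-modules. Define $\delta_0(N)=0$ and, for $m\geq 1$, let $\delta_m(N)$ be the submodule of $N$ containing $\delta_{m-1}(N)$ with $\delta_m(N)/\delta_{m-1}(N)=\delta(N/\delta_{m-1}(N))$. For $N\in\mathcal{F}(\Delta)$, the chain $0\subset\delta_1(N)\subset\cdots\subset\delta_t(N)=N$, where $t\ge 0$ is least with $\delta_t(N)=N$, is the $\Delta$-semisimple filtration of $N$, and $\operatorname{\Delta.ssl}(N)=t$ is its $\Delta$-semisimple length. The socle series is $\operatorname{Soc}_0M=0$, $\operatorname{Soc}_{m}M/\operatorname{Soc}_{m-1}M=\operatorname{Soc}(M/\operatorname{Soc}_{m-1}M)$. For $M_1\subseteq M_2$, $\operatorname{Hom}_A(G,M_1)$ is regarded as a submodule of $\operatorname{Hom}_A(G,M_2)$. *)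

(* Defs.v *)
From HB Require Import structures.
From mathcomp Require Import all_boot all_order all_algebra.
From mathcomp Require Import ring_quotient.
From mathcomp Require Import boolp.

Set Implicit Arguments.
Unset Strict Implicit.
Unset Printing Implicit Defensive.

Import GRing.Theory.

Local Open Scope ring_scope.
Local Open Scope quotient_scope.

Section SubmoduleConstructions.
Variables (R : pzRingType) (M : lmodType R).

Definition zero_sub : {pred M} := [pred x | x == 0].

Fact zero_sub_closed : subsemimod_closed zero_sub.
Proof.
split; first split; first by rewrite inE.
- by move=> x y; rewrite !inE => /eqP-> /eqP->; rewrite addr0.
- by move=> a x; rewrite !inE => /eqP->; rewrite scaler0.
Qed.

HB.instance Definition _ := GRing.isSubmodClosed.Build R M zero_sub
  zero_sub_closed.

Definition full_sub : {pred M} := [pred x | true].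

Fact full_sub_closed : subsemimod_closed full_sub.
Proof. by []. Qed.

HB.instance Definition _ := GRing.isSubmodClosed.Build R M full_sub
  full_sub_closed.

(* The sum of an arbitrary family of submodules: all finite sums of elements
   of its members. *)
Definition sum_sub (I : Type) (F : I -> submodClosed M) : {pred M} :=
  [pred x | `[< exists n (i : 'I_n -> I) (y : 'I_n -> M),
                  (forall j, y j \in F (i j)) /\ x = \sum_j y j >]].

Fact sum_sub_closed I (F : I -> submodClosed M) : subsemimod_closed (sum_sub F).
Proof.
split; first split.
- rewrite inE; apply/asboolP.
  have F0 (P : Type) : 'I_0 -> P by case.
  by exists 0%N, (F0 I), (F0 M); split; [case | rewrite big_ord0].
- move=> x z; rewrite !inE.
  move=> /asboolP[n [i [y [yF ->]]]] /asboolP[m [i' [y' [yF' ->]]]].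
  apply/asboolP; exists (n + m)%N.
  exists (fun j => match split j with inl a => i a | inr b => i' b end).
  exists (fun j => match split j with inl a => y a | inr b => y' b end).
  split; first by move=> j; case: (split j).
  rewrite big_split_ord /=; congr (_ + _); apply: eq_bigr => j _.
    by rewrite (unsplitK (inl _ j)).
  by rewrite (unsplitK (inr _ j)).
- move=> a x; rewrite !inE => /asboolP[n [i [y [yF ->]]]]; apply/asboolP.
  exists n, i, (fun j => a *: y j); split; last by rewrite scaler_sumr.
  by move=> j; apply: rpredZ.
Qed.

HB.instance Definition _ I F := GRing.isSubmodClosed.Build R M (@sum_sub I F)
  (sum_sub_closed F).

Variable N : lmodType R.

Definition image_sub (f : {linear N -> M}) : {pred M} :=
  [pred x | `[< exists y, f y = x >]].

Fact image_sub_closed f : subsemimod_closed (image_sub f).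
Proof.
split; first split; rewrite ?inE.
- by apply/asboolP; exists 0; rewrite linear0.
- move=> x z; rewrite !inE => /asboolP[y <-] /asboolP[w <-].
  by apply/asboolP; exists (y + w); rewrite linearD.
- move=> a x; rewrite !inE => /asboolP[y <-].
  by apply/asboolP; exists (a *: y); rewrite linearZ.
Qed.

HB.instance Definition _ f := GRing.isSubmodClosed.Build R M (image_sub f)
  (image_sub_closed f).

Definition preimage_sub (f : {linear M -> N}) (S : submodClosed N) : {pred M} :=
  [pred x | f x \in S].

Fact preimage_sub_closed f S : subsemimod_closed (preimage_sub f S).
Proof.
split; first split; rewrite ?inE ?linear0 ?rpred0 //.
- by move=> x z; rewrite !inE linearD; apply: rpredD.
- by move=> a x; rewrite !inE linearZ; apply: rpredZ.
Qed.

HB.instance Definition _ f S := GRing.isSubmodClosed.Build R M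
  (preimage_sub f S) (preimage_sub_closed f S).

End SubmoduleConstructions.

Arguments zero_sub {R} M _.
Arguments full_sub {R} M _.

Section QuotientModule.
Variables (R : pzRingType) (M : lmodType R) (S : submodClosed M).

(* [submodClosed] does not inherit from [zmodClosed], which the quotients of
   [ring_quotient] require. *)
Definition zmod_sub : {pred M} := S.

Fact zmod_sub_closed : zmod_closed zmod_sub.
Proof. exact/GRing.submod_closedB/submodClosedP. Qed.

HB.instance Definition _ := GRing.isZmodClosed.Build M zmod_sub zmod_sub_closed.

Definition quotmod : Type := Quotient.quot zmod_sub.

HB.instance Definition _ := ZmodQuotient.on quotmod.

Definition quot_scale (a : R) (x : quotmod) : quotmod :=
  \pi_quotmod (a *: repr x).

Fact pi_scale a x : \pi_quotmod (a *: x) = quot_scale a (\pi_quotmod x).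
Proof.
apply/eqP; rewrite -Quotient.idealrBE -scalerBr.
by apply: (rpredZ (s := S)); rewrite -[_ \in _]/(_ \in zmod_sub)
  Quotient.idealrBE reprK.
Qed.

Fact quot_scaleA a b x :
  quot_scale a (quot_scale b x) = quot_scale (a * b) x.
Proof. by rewrite -[x]reprK -(pi_scale b) -(pi_scale a) -pi_scale scalerA. Qed.

Fact quot_scale1 : left_id 1 quot_scale.
Proof. by move=> x; rewrite -[x]reprK -!pi_scale scale1r. Qed.

Fact quot_scaleDr : right_distributive quot_scale +%R.
Proof.
move=> a x y; rewrite -[x]reprK -[y]reprK.
by rewrite -(raddfD \pi_quotmod) -!pi_scale scalerDr raddfD.
Qed.

Fact quot_scaleDl x : {morph quot_scale^~ x : a b / a + b}.
Proof. by move=> a b; rewrite -[x]reprK -!pi_scale scalerDl raddfD. Qed.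

HB.instance Definition _ := GRing.Zmodule_isLmodule.Build R quotmod
  quot_scaleA quot_scale1 quot_scaleDr quot_scaleDl.

Definition quot_proj (x : M) : quotmod := \pi_quotmod x.

Fact quot_proj_linear : linear quot_proj.
Proof.
by move=> a x y; rewrite /quot_proj (raddfD \pi_quotmod); congr (_ + _);
  apply: pi_scale.
Qed.

HB.instance Definition _ := GRing.isLinear.Build R M quotmod _ quot_proj
  quot_proj_linear.

End QuotientModule.

Section DirectSum.
Variables (R : pzRingType) (I : finType) (V : I -> lmodType R).

Definition dirsum : Type := {dffun forall i, V i}.

HB.instance Definition _ := Choice.on dirsum.

Implicit Types f g : dirsum.

Definition dirsum_zero : dirsum := [ffun i => 0 : V i].
Definition dirsum_opp f : dirsum := [ffun i => - f i : V i].
Definition dirsum_add f g : dirsum := [ffun i => f i + g i : V i].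
Definition dirsum_scale a f : dirsum := [ffun i => a *: f i : V i].

Fact dirsum_addA : associative dirsum_add.
Proof. by move=> f g h; apply/ffunP => i; rewrite !ffunE addrA. Qed.
Fact dirsum_addC : commutative dirsum_add.
Proof. by move=> f g; apply/ffunP => i; rewrite !ffunE addrC. Qed.
Fact dirsum_add0 : left_id dirsum_zero dirsum_add.
Proof. by move=> f; apply/ffunP => i; rewrite !ffunE add0r. Qed.
Fact dirsum_addN : left_inverse dirsum_zero dirsum_opp dirsum_add.
Proof. by move=> f; apply/ffunP => i; rewrite !ffunE addNr. Qed.

HB.instance Definition _ := GRing.isZmodule.Build dirsum
  dirsum_addA dirsum_addC dirsum_add0 dirsum_addN.

Fact dirsum_scaleA a b f :
  dirsum_scale a (dirsum_scale b f) = dirsum_scale (a * b) f.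
Proof. by apply/ffunP => i; rewrite !ffunE scalerA. Qed.
Fact dirsum_scale1 : left_id 1 dirsum_scale.
Proof. by move=> f; apply/ffunP => i; rewrite !ffunE scale1r. Qed.
Fact dirsum_scaleDr : right_distributive dirsum_scale +%R.
Proof. by move=> a f g; apply/ffunP => i; rewrite !ffunE scalerDr. Qed.
Fact dirsum_scaleDl f : {morph dirsum_scale^~ f : a b / a + b}.
Proof. by move=> a b; apply/ffunP => i; rewrite !ffunE scalerDl. Qed.

HB.instance Definition _ := GRing.Zmodule_isLmodule.Build R dirsum
  dirsum_scaleA dirsum_scale1 dirsum_scaleDr dirsum_scaleDl.

End DirectSum.

Section LinHom.
Variables (R : pzRingType) (U V : lmodType R).

Definition LinHom : Type := {linear U -> V}.

HB.instance Definition _ := gen_eqMixin LinHom.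
HB.instance Definition _ := gen_choiceMixin LinHom.

Definition hom_fun (f : LinHom) : {linear U -> V} := f.
Coercion hom_fun : LinHom >-> GRing.Linear.type.

Implicit Types f g h : LinHom.

Lemma homP f g : f =1 g -> f = g.
Proof.
move=> fg; have {fg} := funext fg.
case: f => [f [[f1] [f2]]]; case: g => [g [[g1] [g2]]] /= fg.
rewrite /hom_fun /= in fg; rewrite {}fg in f1 f2 *.
by rewrite (Prop_irrelevance f1 g1) (Prop_irrelevance f2 g2).
Qed.

Definition hom_zero : LinHom := \0 : {linear U -> V}.
Definition hom_opp f : LinHom := \- f : {linear U -> V}.
Definition hom_add f g : LinHom := f \+ g : {linear U -> V}.

Fact hom_addA : associative hom_add.
Proof. by move=> f g h; apply: homP => x /=; rewrite addrA. Qed.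
Fact hom_addC : commutative hom_add.
Proof. by move=> f g; apply: homP => x /=; rewrite addrC. Qed.
Fact hom_add0 : left_id hom_zero hom_add.
Proof. by move=> f; apply: homP => x /=; rewrite add0r. Qed.
Fact hom_addN : left_inverse hom_zero hom_opp hom_add.
Proof. by move=> f; apply: homP => x /=; rewrite addNr. Qed.

HB.instance Definition _ := GRing.isZmodule.Build LinHom
  hom_addA hom_addC hom_add0 hom_addN.

End LinHom.

Section EndomorphismRing.
Variables (R : pzRingType) (G : lmodType R).

Definition Endo : Type := LinHom G G.

HB.instance Definition _ := GRing.Zmodule.on Endo.

Definition endo_one : Endo := idfun : {linear G -> G}.
Definition endo_mul (f g : Endo) : Endo :=
  hom_fun f \o hom_fun g : {linear G -> G}.

Fact endo_mulA : associative endo_mul.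
Proof. by move=> f g h; apply: homP. Qed.
Fact endo_mul1l : left_id endo_one endo_mul.
Proof. by move=> f; apply: homP. Qed.
Fact endo_mul1r : right_id endo_one endo_mul.
Proof. by move=> f; apply: homP. Qed.
Fact endo_mulDl : left_distributive endo_mul +%R.
Proof. by move=> f g h; apply: homP. Qed.
Fact endo_mulDr : right_distributive endo_mul +%R.
Proof. by move=> f g h; apply: homP => x; apply: (linearD (hom_fun f)). Qed.

HB.instance Definition _ := GRing.Zmodule_isPzRing.Build Endo
  endo_mulA endo_mul1l endo_mul1r endo_mulDl endo_mulDr.

End EndomorphismRing.

Section HomModule.
Variables (R : pzRingType) (G M : lmodType R).

(* Hom(G, M) is a left module over End(G)^op by precomposition. *)
Definition hom_scale (a : (Endo G)^c) (f : LinHom G M) : LinHom G M :=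
  hom_fun f \o hom_fun (a : Endo G) : {linear G -> M}.

Fact hom_scaleA a b f : hom_scale a (hom_scale b f) = hom_scale (a * b) f.
Proof. exact: homP. Qed.
Fact hom_scale1 : left_id 1 hom_scale.
Proof. by move=> f; apply: homP. Qed.
Fact hom_scaleDr : right_distributive hom_scale +%R.
Proof. by move=> a f g; apply: homP. Qed.
Fact hom_scaleDl f : {morph hom_scale^~ f : a b / a + b}.
Proof. by move=> a b; apply: homP => x; apply: (linearD (hom_fun f)). Qed.

HB.instance Definition _ :=
  GRing.Zmodule_isLmodule.Build (Endo G)^c (LinHom G M)
    hom_scaleA hom_scale1 hom_scaleDr hom_scaleDl.

Variable S : submodClosed M.

(* Hom(G, S), for a submodule S of M, as a submodule of Hom(G, M). *)
Definition hom_sub : {pred LinHom G M} :=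
  [pred f : LinHom G M | `[< forall x, f x \in S >]].

Fact hom_sub_closed : subsemimod_closed hom_sub.
Proof.
split; first split; rewrite ?inE.
- by apply/asboolP => x; apply: (rpred0 S).
- move=> f g; rewrite !inE => /asboolP fS /asboolP gS.
  by apply/asboolP => x; apply: (rpredD (S := S)).
- move=> a f; rewrite !inE => /asboolP fS.
  by apply/asboolP => x; apply: fS.
Qed.

HB.instance Definition _ := GRing.isSubmodClosed.Build (Endo G)^c (LinHom G M)
  hom_sub hom_sub_closed.

End HomModule.

Arguments hom_sub {R} G {M} S _.

Definition is_least (p : nat -> Prop) (n : nat) : Prop :=
  p n /\ forall m, p m -> (n <= m)%N.

Section ModuleNotions.
Variables (R : pzRingType).
Implicit Types M N : lmodType R.

Definition fin_gen M : Prop :=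
  exists n (e : 'I_n -> M), forall x, exists c : 'I_n -> R,
    x = \sum_i c i *: e i.

Definition artinian M : Prop :=
  forall S : nat -> submodClosed M,
    (forall m, {subset S m.+1 <= S m}) ->
    exists m, forall p, (m <= p)%N -> S p =i S m.

Definition projective M : Prop :=
  forall (X Y : lmodType R) (g : {linear X -> Y}) (f : {linear M -> Y}),
    (forall y, exists x, g x = y) ->
    exists h : {linear M -> X}, forall x, g (h x) = f x.

Definition indecomposable M : Prop :=
  (exists x : M, x != 0) /\
  forall S T : submodClosed M,
    (forall x, x \in S -> x \in T -> x = 0) ->
    (forall x, exists y z, [/\ y \in S, z \in T & x = y + z]) ->
    S =i zero_sub M \/ T =i zero_sub M.

Definition isomorphic M N : Prop :=
  exists f : {linear M -> N}, bijective f.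

(* T is a maximal (proper) submodule of the submodule S. *)
Definition maximal_in M (S T : submodClosed M) : Prop :=
  [/\ {subset T <= S}, ~ T =i S &
      forall U : submodClosed M,
        {subset T <= U} -> {subset U <= S} -> U =i T \/ U =i S].

Definition simple_sub M (S : submodClosed M) : Prop :=
  ~ S =i zero_sub M /\
  forall T : submodClosed M,
    {subset T <= S} -> T =i zero_sub M \/ T =i S.

(* The radical of the submodule S, computed inside M. *)
Definition rad_sub M (S : submodClosed M) : {pred M} :=
  [pred x in S | `[< forall T, maximal_in S T -> x \in T >]].

Fact rad_sub_closed M (S : submodClosed M) : subsemimod_closed (rad_sub S).
Proof.
split; first split.
- rewrite inE rpred0; apply/asboolP => T _; exact: rpred0.
- move=> x y; rewrite !inE => /andP[xS /asboolP xT] /andP[yS /asboolP yT].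
  rewrite rpredD //=; apply/asboolP => T mT.
  by apply: rpredD; [apply: xT | apply: yT].
- move=> a x; rewrite !inE => /andP[xS /asboolP xT].
  by rewrite rpredZ //=; apply/asboolP => T mT; apply: rpredZ; apply: xT.
Qed.

HB.instance Definition _ M S := GRing.isSubmodClosed.Build R M (@rad_sub M S)
  (rad_sub_closed S).

Fixpoint radn M (j : nat) : submodClosed M :=
  if j is j'.+1 then rad_sub (radn M j') else full_sub M.

Definition loewy_length M (t : nat) : Prop :=
  is_least (fun j => radn M j =i zero_sub M) t.

(* The sum of the images of all homomorphisms from members of the family X. *)
Definition trace (I : Type) (X : I -> lmodType R) M : submodClosed M :=
  sum_sub (fun f : {i : I & {linear X i -> M}} => image_sub (tagged f)).

Definition soc M : submodClosed M :=
  sum_sub (fun S : {S : submodClosed M | simple_sub S} => sval S).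

(* The ascending series t_0 = 0, t_m+1 M / t_m M = t (M / t_m M). *)
Fixpoint preradical_series (t : forall M, submodClosed M) (m : nat) M :
    submodClosed M :=
  if m is m'.+1
  then preimage_sub (quot_proj (preradical_series t m' M))
                    (t (quotmod (preradical_series t m' M)))
  else zero_sub M.

Definition socn := preradical_series soc.

End ModuleNotions.

Definition artin_algebra (k : comPzRingType) (A : algType k) : Prop :=
  artinian k^o /\ fin_gen (A : lmodType k).

(* A complete irredundant list of the indecomposable finitely generated
   projective modules. *)
Definition complete_proj_indec (A : pzRingType) n (P : 'I_n -> lmodType A) :=
  [/\ forall i, [/\ fin_gen (P i), projective (P i) & indecomposable (P i)],
      forall i j, isomorphic (P i) (P j) -> i = j &
      forall Q : lmodType A, fin_gen Q -> projective Q -> indecomposable Q ->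
        exists i, isomorphic (P i) Q].

Section ADR.
Variables (A : pzRingType) (n : nat) (P : 'I_n -> lmodType A) (l : 'I_n -> nat).

(* Indices count the second coordinate from 0: the pair (i, j) stands for
   (i, j + 1). *)
Definition adr_index : finType := {i : 'I_n & 'I_(l i)}.

Definition adr_le (x y : adr_index) : bool :=
  (x == y) || (tagged y < tagged x)%N.

Definition adr_summand (x : adr_index) : lmodType A :=
  quotmod (radn (P (tag x)) (tagged x).+1).

Definition adr_gen : lmodType A := dirsum adr_summand.

Definition adr_algebra : pzRingType := (Endo adr_gen)^c.

Definition adr_hom (M : lmodType A) : lmodType adr_algebra := LinHom adr_gen M.

Definition adr_proj (x : adr_index) : lmodType adr_algebra :=
  adr_hom (adr_summand x).

Definition adr_std (x : adr_index) : lmodType adr_algebra :=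
  quotmod (trace
    (fun _ : unit =>
       dirsum (fun y : {y : adr_index | ~~ adr_le y x} => adr_proj (val y)))
    (adr_proj x)).

Definition delta (N : lmodType adr_algebra) : submodClosed N := trace adr_std N.

Definition deltan := preradical_series delta.

Definition delta_ssl (N : lmodType adr_algebra) (t : nat) : Prop :=
  is_least (fun m => deltan m N =i full_sub N) t.

End ADR.

(* Main.v *)
Require Import Defs.
From HB Require Import structures.
From mathcomp Require Import all_boot all_order all_algebra.
From mathcomp Require Import boolp.
From mathcomp Require classical_sets.

Set Implicit Arguments.
Unset Strict Implicit.
Unset Printing Implicit Defensive.

Import GRing.Theory.

Local Open Scope ring_scope.

(* Let J be the Jacobson radical of A and (U : J) = {x | J x <= U}. As A is left
   artinian, modules killed by J are semisimple, so Soc M = (0 : J), and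
   Rad S <= U iff S <= (U : J) for submodules S, U of M. Both Loewy series are
   thus governed by iterating the operator (_ : J).

   A homomorphism from Delta(i,j) to Hom(G, N) comes, by Yoneda, from a map
   P_i/Rad^j P_i -> N that vanishes on the radical, because
   Delta(i,j) = Hom(G, P_i/Rad^j P_i) / Hom(G, Rad P_i/Rad^j P_i) and G is a
   generator; hence its image lies in Hom(G, Soc N). Since
   Hom(G, M)/Hom(G, Soc_m M) embeds in Hom(G, M/Soc_m M), this bounds delta_m+1
   from above. Conversely, a map P_i/Rad^j P_i -> Soc_m+1 M sends the radical to
   Soc_m M, so modulo Hom(G, Soc_m M) it induces a map from Delta(i,j); such
   maps cover Hom(G, Soc_m+1 M). *)

(** * Sums, intersections and extremal submodules *)

Section Submodules.
Variables (R : pzRingType) (M : lmodType R).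
Implicit Types S T U : submodClosed M.

Lemma mem_subB S x y : x \in S -> y \in S -> x - y \in S.
Proof. by move=> xS yS; rewrite rpredD // -scaleN1r rpredZ. Qed.

Lemma in_addl S x y : x \in S -> (x + y \in S) = (y \in S).
Proof.
move=> xS; apply/idP/idP => [xyS|]; last exact: rpredD.
by rewrite -(addKr x y) addrC mem_subB.
Qed.

Lemma sum_sub_le (I : Type) (F : I -> submodClosed M) U :
  (forall i, {subset F i <= U}) -> {subset sum_sub F <= U}.
Proof.
move=> FU x /asboolP[n [i [y [yF ->]]]].
by apply: rpred_sum => j _; apply: FU (yF j).
Qed.

Lemma sum_sub_ge (I : Type) (F : I -> submodClosed M) i :
  {subset F i <= sum_sub F}.
Proof.
move=> x xF; apply/asboolP; exists 1%N, (fun=> i), (fun=> x).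
by split=> //; rewrite big_ord1.
Qed.

Definition add_sub S T : {pred M} :=
  [pred x | `[< exists y z, [/\ y \in S, z \in T & x = y + z] >]].

Fact add_sub_closed S T : subsemimod_closed (add_sub S T).
Proof.
split; first split.
- by apply/asboolP; exists 0, 0; rewrite !rpred0 addr0.
- move=> _ _ /asboolP[y [z [yS zT ->]]] /asboolP[y' [z' [yS' zT' ->]]].
  by apply/asboolP; exists (y + y'), (z + z'); rewrite !rpredD // addrACA.
- move=> a _ /asboolP[y [z [yS zT ->]]]; apply/asboolP.
  by exists (a *: y), (a *: z); rewrite !rpredZ // scalerDr.
Qed.

HB.instance Definition _ S T := GRing.isSubmodClosed.Build R M (add_sub S T)
  (add_sub_closed S T).

Definition cap_sub S T : {pred M} := [pred x | (x \in S) && (x \in T)].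

Fact cap_sub_closed S T : subsemimod_closed (cap_sub S T).
Proof.
split; first by split=> [|x y]; rewrite !inE ?rpred0 // =>
  /andP[? ?] /andP[? ?]; rewrite !rpredD.
by move=> a x; rewrite !inE => /andP[? ?]; rewrite !rpredZ.
Qed.

HB.instance Definition _ S T := GRing.isSubmodClosed.Build R M (cap_sub S T)
  (cap_sub_closed S T).

Lemma add_subP S T x :
  reflect (exists y z, [/\ y \in S, z \in T & x = y + z]) (x \in add_sub S T).
Proof. exact: asboolP. Qed.

Lemma add_subl S T : {subset S <= add_sub S T}.
Proof. by move=> x xS; apply/add_subP; exists x, 0; rewrite rpred0 addr0. Qed.

Lemma add_subr S T : {subset T <= add_sub S T}.
Proof. by move=> x xT; apply/add_subP; exists 0, x; rewrite rpred0 add0r. Qed.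

Lemma add_sub_le S T U :
  {subset S <= U} -> {subset T <= U} -> {subset add_sub S T <= U}.
Proof.
by move=> SU TU x /add_subP[y [z [/SU ? /TU ? ->]]]; apply: rpredD.
Qed.

(** Its image is the cyclic submodule R x; the preimage of a submodule is the left ideal carrying x
    into it. *)
Definition mulr_point (x : M) (a : R^o) : M := (a : R) *: x.

Fact mulr_point_linear (x : M) : linear (mulr_point x).
Proof. by move=> a b c; rewrite /mulr_point scalerDl scalerA. Qed.

HB.instance Definition _ (x : M) := GRing.isLinear.Build R R^o M _
  (mulr_point x) (mulr_point_linear x).

(** Zorn's lemma: a nonempty chain is bounded by the sum of its members, which still misses x. *)
Lemma maximal_avoiding S x : x \notin S ->
  exists T, [/\ {subset S <= T}, x \notin T &
    forall U, {subset T <= U} -> x \notin U -> {subset U <= T}].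
Proof.
move=> xS.
pose X := {T : submodClosed M | {subset S <= T} /\ x \notin T}.
pose r (T U : X) := `[< {subset sval T <= sval U} >].
have S0 : X by exists S; split.
have [|||[T [ST xT]] Tmax] := @classical_sets.ZL_preorder X S0 r.
- by move=> T; apply/asboolP.
- move=> T U V /asboolP UT /asboolP TV; apply/asboolP => y /UT; exact: TV.
- move=> C Ctot; have [[T0 CT0]|C0] := pselect (exists T : X, C T); last first.
    by exists S0 => T CT; case: C0; exists T.
  pose F (T : {T : X | C T}) : submodClosed M := sval (sval T).
  (* Finitely many elements of members of the chain lie in a single member, so the sum of the chain
     is its union. *)
  have dir : forall n (i : 'I_n -> {T : X | C T}) (y : 'I_n -> M),
      (forall j, y j \in F (i j)) ->
      exists T : {T : X | C T}, forall j, y j \in F T.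
    elim=> [|n IHn] i y yF; first by exists (exist _ T0 CT0); case.
    have [//|[T CT] yT] := IHn (i \o lift ord0) (y \o lift ord0).
      by move=> j; exact: yF.
    have := yF ord0; case: (i ord0) => T' CT' yT'.
    have [/asboolP TT'|/asboolP TT'] := Ctot _ _ CT CT'.
      exists (exist _ T' CT') => j; have [j' ->|->//] := unliftP ord0 j.
      exact/TT'/yT.
    exists (exist _ T CT) => j; have [j' ->|->] := unliftP ord0 j.
      exact: yT.
    exact: TT'.
  have UP : {subset S <= sum_sub F} /\ x \notin sum_sub F.
    split.
      move=> y yS; apply: (@sum_sub_ge _ F (exist _ T0 CT0)).
      by have [ST0 _] := svalP T0; exact: ST0.
    apply/negP => /asboolP[n [i [y [/dir[T yT] xE]]]].
    have [_ /negP] := svalP (sval T); apply.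
    suff : \sum_j y j \in F T by rewrite -xE.
    by apply: rpred_sum => j _; exact: yT.
  exists (exist _ (sum_sub F : submodClosed M) UP) => T CT; apply/asboolP.
  exact: (@sum_sub_ge _ F (exist _ T CT)).
exists T; split=> // U TU xU.
have SU : {subset S <= U} by move=> y /ST /TU.
by apply/asboolP; apply: (Tmax (exist _ U (conj SU xU))); apply/asboolP.
Qed.

(** Otherwise dependent choice builds a strictly descending chain. *)
Lemma artinian_min (Q : submodClosed M -> Prop) : artinian M ->
  (exists S, Q S) ->
  exists S, Q S /\ forall T, Q T -> {subset T <= S} -> {subset S <= T}.
Proof.
move=> artM [S0 QS0]; apply: contrapT => noMin.
pose X := {S | Q S}.
have step (S : X) : {T : X | {subset sval T <= sval S} /\
    ~ {subset sval S <= sval T}}.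
  apply: cid; apply: contrapT => noT; apply: noMin.
  case: S noT => S QS noT; exists S; split=> // T QT TS.
  by apply: contrapT => ST; apply: noT; exists (exist _ T QT).
have [f [_ fS]] := dependent_choice step (exist _ S0 QS0 : X).
have [m|m fm] := artM (fun m => sval (f m)); first exact: (fS m).1.
by have [_] := fS m; apply => x; rewrite -(fm m.+1).
Qed.

End Submodules.

(** * Submodules and quotients as modules *)

Section Submod.
Variables (R : pzRingType) (M : lmodType R) (S : submodClosed M).

Definition submod := {x : M | x \in S}.
HB.instance Definition _ := SubChoice.on submod.
HB.instance Definition _ := [SubChoice_isSubLmodule of submod by <:].

Definition incl : submod -> M := val.
HB.instance Definition _ := GRing.Linear.copy incl (val : submod -> M).

Lemma incl_in (x : submod) : incl x \in S.
Proof. exact: valP. Qed.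

Lemma incl_inj : injective incl.
Proof. exact: val_inj. Qed.

Variables (N : lmodType R) (f : {linear N -> M}).
Hypothesis fS : forall x, f x \in S.

Definition corestr (x : N) : submod := exist _ (f x) (fS x).

Fact corestr_linear : linear corestr.
Proof. by move=> a x y; apply: incl_inj; rewrite linearP /incl /= linearP. Qed.

HB.instance Definition _ := GRing.isLinear.Build R N submod _ corestr
  corestr_linear.

End Submod.

Section Quotients.
Variables (R : pzRingType) (M : lmodType R) (S : submodClosed M).

Lemma quot_proj_eq x y : (quot_proj S x == quot_proj S y) = (x - y \in S).
Proof. by rewrite /quot_proj -Quotient.idealrBE. Qed.

Lemma quot_proj_eq0 x : (quot_proj S x == 0) = (x \in S).
Proof. by rewrite -(linear0 (quot_proj S)) quot_proj_eq subr0. Qed.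

Lemma quot_projK (x : quotmod S) : quot_proj S (repr x) = x.
Proof. exact: reprK. Qed.

Lemma quot_ind (Q : quotmod S -> Prop) :
  (forall x, Q (quot_proj S x)) -> forall x, Q x.
Proof. by move=> H x; rewrite -(quot_projK x). Qed.

Variables (N : lmodType R) (f : {linear M -> N}).
Hypothesis fS : forall x, x \in S -> f x = 0.

(** The vanishing proof is an argument so that linearity can be inferred from the term. *)
Definition quot_lift (_ : forall x, x \in S -> f x = 0) (x : quotmod S) : N :=
  f (repr x).

Lemma quot_liftE x : quot_lift fS (quot_proj S x) = f x.
Proof.
apply/eqP; rewrite /quot_lift -subr_eq0 -linearB fS //.
by rewrite -quot_proj_eq quot_projK.
Qed.

Fact quot_lift_linear : linear (quot_lift fS).
Proof.
move=> a x y; elim/quot_ind: x => x; elim/quot_ind: y => y.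
by rewrite -linearP !quot_liftE linearP.
Qed.

HB.instance Definition _ := GRing.isLinear.Build R (quotmod S) N _
  (quot_lift fS) quot_lift_linear.

End Quotients.

Arguments quot_lift {R M S N f} _ _ : simpl never.

(** * The Jacobson radical and the two Loewy series *)

Section Radical.
Variable R : pzRingType.
Implicit Types M N : lmodType R.

Definition jac : submodClosed R^o := rad_sub (full_sub R^o).

Lemma mulr_point1 M (x : M) : mulr_point x 1 = x.
Proof. exact: scale1r. Qed.

Lemma mem_cyclic M (x : M) : x \in image_sub (mulr_point x).
Proof. by apply/asboolP; exists 1; apply: mulr_point1. Qed.

Lemma left_idealM (I : submodClosed R^o) (a b : R) : b \in I -> a * b \in I.
Proof. exact: rpredZ. Qed.

Lemma left_ideal1 (I : submodClosed R^o) (a : R) : (1 : R) \in I -> a \in I.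
Proof. by move/(left_idealM a); rewrite mulr1. Qed.

Lemma maximal_add M (S T : submodClosed M) x y :
  maximal_in S T -> x \in S -> x \notin T -> y \in S ->
  exists a z, z \in T /\ y = z + a *: x.
Proof.
move=> [TS TnS Tmax] xS xT yS.
pose W : submodClosed M := add_sub T (image_sub (mulr_point x)).
have xW : x \in W.
  exact/add_subr/mem_cyclic.
have [||WT|WS] := Tmax W; first exact: add_subl.
- by apply: add_sub_le => // _ /asboolP[c <-]; rewrite /mulr_point rpredZ.
- by move: xW; rewrite WT (negbTE xT).
- have : y \in W by rewrite WS.
  by case/add_subP=> z [_ [zT /asboolP[a <-] ->]]; exists a, z.
Qed.

(** For x in S outside a maximal submodule T, the left ideal of all b with b x in T is maximal,
    hence contains [jac]. *)
Lemma jac_scale M (S : submodClosed M) a x :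
  a \in jac -> x \in S -> a *: x \in rad_sub S.
Proof.
move=> aJ xS; rewrite inE rpredZ //=; apply/asboolP => T Tmax.
have [xT|xT] := boolP (x \in T); first exact: rpredZ.
pose I : submodClosed R^o := preimage_sub (mulr_point x) T.
suff Imax : maximal_in (full_sub R^o) I.
  by case/andP: aJ => _ /asboolP/(_ _ Imax).
split=> [//||U IU _].
  by move/(_ 1); rewrite !inE /= mulr_point1 (negbTE xT).
have [UT|nUT] := pselect ({subset U <= I}).
  by left=> b; apply/idP/idP => [/UT|/IU].
right=> b; rewrite [RHS]inE.
have [u uU uI] : exists2 u, u \in U & u \notin I.
  apply: contrapT => H; apply: nUT => u uU.
  by apply: contrapT => /negP uI; apply: H; exists u.
(* As u x lies outside T, x = z + c u x with z in T; so 1 - c u lies in I, and 1 in U. *)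
have uxS : (u : R) *: x \in S by rewrite rpredZ.
have [c [z [zT xE]]] := maximal_add Tmax uxS uI xS.
have /IU H1 : 1 - c * u \in I.
  suff E : ((1 - c * u) : R) *: x = z by rewrite -E in zT.
  by rewrite scalerBl scale1r -scalerA {1}xE addrK.
apply: left_ideal1; rewrite -(subrK (c * u) 1); apply: rpredD H1 _.
exact: left_idealM.
Qed.

(** So [jac] is two-sided, which closes [colon U] under scalars. *)
Lemma jac_mulr (a b : R) : a \in jac -> a * b \in jac.
Proof. by move=> aJ; apply: (@jac_scale R^o (full_sub R^o)). Qed.

Definition colon M (U : submodClosed M) : {pred M} :=
  [pred x | `[< forall a, a \in jac -> a *: x \in U >]].

Fact colon_closed M (U : submodClosed M) : subsemimod_closed (colon U).
Proof.
split; first split.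
- by apply/asboolP => a _; rewrite scaler0 rpred0.
- move=> x y /asboolP xU /asboolP yU; apply/asboolP => a aJ.
  by rewrite scalerDr rpredD ?xU ?yU.
- move=> a x /asboolP xU; apply/asboolP => b bJ.
  by rewrite scalerA; apply/xU/jac_mulr.
Qed.

HB.instance Definition _ M U := GRing.isSubmodClosed.Build R M (@colon M U)
  (colon_closed U).

Lemma colonP M (U : submodClosed M) x :
  reflect (forall a, a \in jac -> a *: x \in U) (x \in colon U).
Proof. exact: asboolP. Qed.

Lemma colon_le M (U V : submodClosed M) :
  {subset U <= V} -> {subset colon U <= colon V}.
Proof. by move=> UV x /colonP xU; apply/colonP => a /xU/UV. Qed.

Lemma colon_preim M N (f : {linear M -> N}) (U : submodClosed N) x :
  (f x \in colon U) = (x \in colon (preimage_sub f U)).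
Proof.
by apply/colonP/colonP => H a /H; rewrite inE /= linearZ.
Qed.

(** Holds over every ring, because J S lies in Rad S. *)
Lemma rad_sub_le M (S U : submodClosed M) :
  {subset rad_sub S <= U} -> {subset S <= colon U}.
Proof. by move=> SU x xS; apply/colonP => a aJ; apply/SU/jac_scale. Qed.

(** Zero is maximal in a simple submodule, so its radical vanishes and J kills it. *)
Lemma soc_le_colon0 M : {subset soc M <= colon (zero_sub M)}.
Proof.
apply: sum_sub_le => -[S [Sn0 Smin]] /=; apply: rad_sub_le => x /andP[_].
move/asboolP; apply; split.
- by move=> y; rewrite inE => /eqP->; rewrite rpred0.
- by move=> E; apply: Sn0 => y; rewrite E.
- by move=> U _ /Smin.
Qed.

Hypothesis artR : artinian R^o.

(* A module killed by [jac] is semisimple. If [a x] lies in the socle only for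
   [a] in a proper left ideal, take a maximal left ideal [m] above it and [K]
   minimal among the left ideals containing [jac] but not contained in [m].
   Then [K] meets [m] in [jac], so that [K x] is zero or simple. *)
Lemma soc_colon M : soc M =i colon (zero_sub M).
Proof.
move=> x; apply/idP/idP => [/soc_le_colon0//|/colonP Jx].
apply: contrapT => /negP xS.
pose T : submodClosed R^o := preimage_sub (mulr_point x) (soc M).
have T1 : 1 \notin T by rewrite inE /= mulr_point1.
have [m [Tm m1 mmax]] := maximal_avoiding T1.
pose Q (K : submodClosed R^o) := {subset jac <= K} /\ ~ {subset K <= m}.
have [|K [[JK Km] Kmin]] := artinian_min (Q := Q) artR.
  exists (full_sub R^o : submodClosed R^o); split=> // H.
  by case/negP: m1; exact: H 1 isT.
(* If y missed a maximal left ideal m', minimality of K would put K :&: m' inside m, and then K = (K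
   :&: m') + R y as well. *)
have KmJ y : y \in K -> y \in m -> y \in jac.
  move=> yK ym; apply/andP; split=> //; apply/asboolP => m' m'max.
  apply: contrapT => /negP ym'; apply: Km => k kK.
  have [c [z [zm' kE]]] := maximal_add m'max (isT : y \in full_sub R^o) ym'
    (isT : k \in full_sub R^o).
  have cyK : c *: y \in K by rewrite rpredZ.
  have zL : z \in cap_sub K m'.
    rewrite inE zm' andbT -(in_addl _ cyK) addrC -kE //.
  suff zm : z \in m by rewrite kE rpredD // rpredZ.
  move: z zL {zm' kE}; apply: contrapT => Lm.
  have : {subset K <= cap_sub K m'}.
    apply: Kmin; last by move=> z /andP[].
    split=> // z zJ; rewrite inE (JK _ zJ) /=.
    by case/andP: zJ => _ /asboolP; apply.
  by move/(_ y yK)/andP => [_]; apply/negP.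
apply: Km => b bK; apply: Tm; rewrite inE /=.
pose Kx : submodClosed M := image_sub (mulr_point x \o @incl _ _ K).
have inKx a : a \in K -> mulr_point x a \in Kx.
  by move=> aK; apply/asboolP; exists (exist _ a aK).
have [Kx0|Kxn0] := pselect (Kx =i zero_sub M).
  by have := inKx b bK; rewrite Kx0 inE => /eqP->; rewrite rpred0.
have Kxs : simple_sub Kx.
  split=> // V VK.
  (* If W lies in m, it lies in [jac], which kills x, so V = 0; otherwise minimality of K gives W =
     K and V = K x. *)
  pose W : submodClosed R^o := cap_sub K (preimage_sub (mulr_point x) V).
  have [Wm|Wm] := pselect ({subset W <= m}).
    left=> z; apply/idP/idP; last by rewrite inE => /eqP->; rewrite rpred0.
    move=> zV; have /asboolP[[a aK] /= zE] := VK _ zV; rewrite -zE in zV *.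
    by apply: Jx; apply: KmJ => //; apply: Wm; rewrite inE aK.
  right=> z; apply/idP/idP => [/VK//|/asboolP[[a aK] /= <-]].
  suff /(_ a aK)/andP[] : {subset K <= W} by [].
  apply: Kmin; last by move=> c /andP[].
  split=> // c cJ; rewrite inE JK //= inE.
  have := Jx c cJ; rewrite inE => /eqP; rewrite /= /mulr_point => ->.
  exact: rpred0.
exact: (@sum_sub_ge _ _ _ _ (exist _ Kx Kxs)) (inKx b bK).
Qed.

(* For [s] outside [U], a submodule [T] of [M] above [U] and maximal avoiding
   [s] meets [S] in a maximal submodule, because [S/(S :&: T)] is
   semisimple and all its nonzero submodules contain [s]. *)
Lemma rad_subP M (S U : submodClosed M) :
  {subset rad_sub S <= U} <-> {subset S <= colon U}.
Proof.
split; first exact: rad_sub_le.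
move=> SU s /andP[sS /asboolP sT]; apply: contrapT => /negP sU.
have [T [UT snT Tmax]] := maximal_avoiding sU.
suff /sT/andP[_] : maximal_in S (cap_sub S T) by apply/negP.
have gen u : u \notin T -> exists a z, z \in T /\ s = z + a *: u.
  move=> uT; pose V : submodClosed M := add_sub T (image_sub (mulr_point u)).
  have [/add_subP[z [_ [zT /asboolP[a <-] ->]]]|sV] := boolP (s \in V).
    by exists a, z.
  case/negP: uT; apply: (Tmax V) => //; first exact: add_subl.
  exact/add_subr/mem_cyclic.
have span u : u \in S -> exists a z, z \in T /\ u = z + a *: s.
  move=> uS; pose q : {linear M -> quotmod T} := quot_proj T.
  pose B : submodClosed (quotmod T) := image_sub (mulr_point (q s)).
  have : q u \in soc (quotmod T).
    rewrite soc_colon colon_preim; apply: colon_le (SU _ uS) => y /UT.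
    by rewrite !inE quot_proj_eq0.
  (* By [gen], each simple submodule of M/T contains the class of s, hence is generated by it. *)
  suff socB : {subset soc (quotmod T) <= B}.
    move/socB/asboolP => [a]; rewrite /= /mulr_point -linearZ => /eqP.
    rewrite eq_sym quot_proj_eq => uT.
    by exists a, (u - (a : R) *: s); rewrite subrK.
  apply: sum_sub_le => -[W [Wn0 Wmin]] /=; apply: quot_ind => w wW.
  have [wT|wT] := boolP (w \in T).
    by move: (wT); rewrite -quot_proj_eq0 => /eqP->; rewrite rpred0.
  have [a [z [zT sE]]] := gen w wT.
  have qsE : q s = a *: q w.
    by apply/eqP; rewrite -linearZ quot_proj_eq sE addrK.
  have BW : {subset B <= W}.
    by move=> _ /asboolP[c <-]; rewrite /mulr_point qsE !rpredZ.
  have [B0|->//] := Wmin B BW.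
  have : q s \in B := mem_cyclic (q s).
  by rewrite B0 inE quot_proj_eq0 (negbTE snT).
split; first by move=> y /andP[].
  by move/(_ s); rewrite inE sS (negbTE snT).
move=> V TV VS.
have [VT|nVT] := pselect ({subset V <= T}).
  by left=> y; apply/idP/idP => [yV|/TV//]; rewrite inE VS ?VT.
right=> y; apply/idP/idP => [/VS//|yS].
have [u uV uT] : exists2 u, u \in V & u \notin T.
  apply: contrapT => H; apply: nVT => u uV.
  by apply: contrapT => /negP uT; apply: H; exists u.
(* Modular law, using that V contains S :&: T. *)
have inV z v : z \in T -> v \in V -> z + v \in S -> z + v \in V.
  move=> zT vV zvS; rewrite rpredD // TV // inE zT andbT.
  by rewrite -(in_addl _ (VS _ vV)) addrC.
have [a [z [zT sE]]] := gen u uT.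
have sV : s \in V by rewrite sE inV ?rpredZ // -sE.
have [b [t [tT yE]]] := span y yS.
by rewrite yE inV ?rpredZ // -yE.
Qed.

(** This is (U : J^j). *)
Fixpoint colonn j M (U : submodClosed M) : submodClosed M :=
  if j is j'.+1 then colon (colonn j' U) else U.

Lemma colonn_le j M (U V : submodClosed M) :
  {subset U <= V} -> {subset colonn j U <= colonn j V}.
Proof. by elim: j => [//|j IHj] UV /=; exact/colon_le/IHj. Qed.

Lemma colonSn j M (U : submodClosed M) : colonn j (colon U) = colonn j.+1 U.
Proof. by elim: j => //= j ->. Qed.

Lemma colon_ge M (U : submodClosed M) : {subset U <= colon U}.
Proof. by move=> x xU; apply/colonP => a _; rewrite rpredZ. Qed.

Lemma colonn_mono i j M (U : submodClosed M) :
  (i <= j)%N -> {subset colonn i U <= colonn j U}.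
Proof.
move/subnK <-; elim: (j - i)%N => [//|d IHd] x /IHd; exact: colon_ge.
Qed.

Lemma colonn_preim j M N (f : {linear M -> N}) (U : submodClosed N) x :
  (f x \in colonn j U) = (x \in colonn j (preimage_sub f U)).
Proof.
elim: j x => [//|j IHj] x /=; rewrite colon_preim.
by apply/idP/idP; apply: colon_le => y; rewrite inE IHj.
Qed.

(** By [rad_subP] each radical on the left becomes a colon on the right; [colonSn] inserts it
    innermost, where the induction needs it. *)
Lemma radn_le j M (U : submodClosed M) :
  {subset radn M j <= U} <-> forall x, x \in colonn j U.
Proof.
elim: j U => [|j IHj] U; first by split=> [H x|H x _]; apply: H.
by rewrite -colonSn -IHj; exact: rad_subP.
Qed.

(** The socle of M/Soc_m M is (0 : J) there, with preimage (Soc_m M : J) in M. *)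
Lemma socn_colonn m M : socn m M =i colonn m (zero_sub M).
Proof.
elim: m => [//|m IHm] x; rewrite [LHS]inE soc_colon colon_preim /=.
have E y : (y \in preimage_sub (quot_proj (socn m M)) (zero_sub _)) =
    (y \in colonn m (zero_sub M)).
  rewrite -IHm. exact: (quot_proj_eq0 (socn m M) y).
by apply/idP/idP; apply: colon_le => y; rewrite E.
Qed.

End Radical.

(** * Finitely generated modules over artinian rings, and Artin algebras *)

Section FinitelyGenerated.
Variables (R : pzRingType) (M : lmodType R).

Fixpoint span (s : seq M) : submodClosed M :=
  if s is x :: s' then add_sub (span s') (image_sub (mulr_point x))
  else zero_sub M.

Lemma mem_span s x : x \in s -> x \in span s.
Proof.
elim: s => // y s IHs /predU1P[->|/IHs xs] /=.
  exact/add_subr/mem_cyclic.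
exact: add_subl.
Qed.

Lemma fin_gen_span : fin_gen M -> exists s, forall x, x \in span s.
Proof.
move=> [n [e eM]]; exists [seq e i | i <- enum 'I_n] => x.
have [c ->] := eM x; apply: rpred_sum => i _; apply: rpredZ.
by apply/mem_span/map_f; rewrite mem_enum.
Qed.

(** Induction on the generators: a chain is constant once its intersections with the span of the
    other generators are, and the left ideals of coefficients of e modulo that span are. *)
Lemma fin_gen_artinian : artinian R^o -> fin_gen M -> artinian M.
Proof.
move=> artR /fin_gen_span[s sM] S Sdecr.
have Sle m p : (m <= p)%N -> {subset S p <= S m}.
  move/subnK <-; elim: (p - m)%N => [//|d IHd] x; rewrite addSn.
  by move/Sdecr/IHd.
suff [m Hm] : exists m, forall p x, (m <= p)%N -> x \in span s ->
    x \in S m -> x \in S p.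
  by exists m => p mp x; apply/idP/idP => [/(Sle _ _ mp)//|/Hm-> //].
elim: s {sM} => [|e s [m1 H1]].
  by exists 0%N => p x _ /=; rewrite inE => /eqP-> _; exact: rpred0.
pose I m : submodClosed R^o :=
  preimage_sub (mulr_point e) (add_sub (S m) (span s)).
have [m a|m2 H2] := artR I.
  suff H : {subset add_sub (S m.+1) (span s) <= add_sub (S m) (span s)}.
    exact: H.
  by apply: add_sub_le => [y /Sdecr|]; [apply: add_subl | apply: add_subr].
exists (maxn m1 m2) => p x; rewrite geq_max => /andP[m1p m2p].
case/add_subP=> y [_ [ys /asboolP[a <-] xE]] xS.
have : a \in I m2.
  apply/add_subP; exists x, (- y); split.
  - exact: Sle (leq_maxr _ _) _ xS.
  - by rewrite -scaleN1r rpredZ.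
  - by rewrite xE addrC addKr.
rewrite -(H2 p m2p) => /add_subP[z [t [zS ts aE]]].
have xzE : x = z + (y + t) by rewrite xE aE addrCA.
rewrite xzE rpredD //; apply: H1 => //; first by rewrite rpredD.
have zS1 : z \in S m1 by exact: Sle m1p _ zS.
by rewrite -(in_addl _ zS1) -xzE; exact: Sle (leq_maxl _ _) _ xS.
Qed.

End FinitelyGenerated.

Section ArtinAlgebra.
Variables (k : comPzRingType) (A : algType k).

Definition scalar_sub (S : submodClosed A^o) : {pred (A : lmodType k)} := S.

Fact scalar_sub_closed S : subsemimod_closed (scalar_sub S).
Proof.
split; first by split; [exact: (rpred0 S) | exact: (rpredD (S := S))].
move=> a x xS; rewrite -[x]mul1r scalerAl.
exact: (@left_idealM A S (a *: 1) x xS).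
Qed.

HB.instance Definition _ S := GRing.isSubmodClosed.Build k (A : lmodType k)
  (scalar_sub S) (scalar_sub_closed S).

(** Left ideals are k-submodules, and A is a finitely generated module over the artinian ring k. *)
Lemma artin_algebra_artinian : artin_algebra A -> artinian A^o.
Proof.
move=> [artk fgA] S Sdecr.
exact: (fin_gen_artinian artk fgA (S := fun m => scalar_sub (S m))) Sdecr.
Qed.

End ArtinAlgebra.

(** * Direct summands and indecomposable projectives *)

Lemma direct_proj (R : pzRingType) (M : lmodType R) (S T : submodClosed M) :
  (forall x, x \in S -> x \in T -> x = 0) ->
  (forall x, exists y z, [/\ y \in S, z \in T & x = y + z]) ->
  exists f : {linear M -> M},
    (forall x, f x \in S) /\ forall x, x \in S -> f x = x.
Proof.
move=> ST0 STM.
have [x|f /all_and2[fS fT]] := boolp.choice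
  (P := fun x y => y \in S /\ x - y \in T).
  by have [y [z [yS zT ->]]] := STM x; exists y; rewrite addrC addKr.
(* Uniqueness of components makes the chosen function linear. *)
have uniqf x y : y \in S -> x - y \in T -> f x = y.
  move=> yS xyT; apply/eqP; rewrite -subr_eq0; apply/eqP/ST0.
    exact: mem_subB.
  have -> : f x - y = (x - y) - (x - f x) by rewrite opprB [RHS]addrC subrKA.
  exact: mem_subB.
have flin : linear f.
  move=> a x y; apply: uniqf; first by rewrite rpredD ?rpredZ.
  rewrite opprD addrACA -scalerBr; apply: rpredD => //; exact: rpredZ.
pose F := GRing.isLinear.Build R M M _ f flin.
pose g : {linear M -> M} := HB.pack f F.
exists g; split=> // x xS; apply: uniqf => //.
by rewrite subrr rpred0.
Qed.

Section ProjectiveIndecomposable.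
Variable R : pzRingType.
Implicit Types M : lmodType R.

Lemma full_sub_max M (T : submodClosed M) :
  maximal_in (full_sub M) T -> ~ forall x, x \in T.
Proof. by case=> _ TM _ H; apply: TM => x; rewrite H. Qed.

(* If [S] lies outside the radical, let [T] be a maximal submodule with
   [S + T = M], shrink [S] to be minimal with this property, and let [K] be
   minimal in [T] with [S + K = M]. Then a lift of [M -> M/K] to [S] is a
   projection of [M] onto [S] with kernel [K]. *)
Lemma proj_indec_local M (S : submodClosed M) :
  artinian M -> projective M -> indecomposable M ->
  ~ {subset S <= rad_sub (full_sub M)} -> forall x, x \in S.
Proof.
move=> artM projM [_ indM] nS.
have [T Tmax ST] : exists2 T, maximal_in (full_sub M) T & ~ {subset S <= T}.
  apply: contrapT => H; apply: nS => x xS; rewrite inE; apply/andP; split=> //.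
  apply/asboolP => T Tmax; apply: contrapT => /negP xT; apply: H.
  by exists T => // /(_ _ xS); apply/negP.
pose Q1 (S' : submodClosed M) :=
  {subset S' <= S} /\ forall x, x \in add_sub S' T.
have [|S1 [[S1S S1T] S1min]] := artinian_min (Q := Q1) artM.
  exists S; split=> // x.
  have [s sS sT] : exists2 s, s \in S & s \notin T.
    apply: contrapT => H; apply: ST => s sS.
    by apply: contrapT => /negP sT; apply: H; exists s.
  have [a [z [zT ->]]] := maximal_add Tmax (isT : s \in full_sub M) sT
    (isT : x \in full_sub M).
  rewrite addrC; apply/add_subP; exists (a *: s), z; split=> //.
  exact: rpredZ.
pose Q2 (K : submodClosed M) :=
  {subset K <= T} /\ forall x, x \in add_sub S1 K.
have [|K [[KT S1K] Kmin]] := artinian_min (Q := Q2) artM.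
  by exists T; split.
have [|h hK] := projM _ _ (quot_proj K \o @incl _ _ S1 : {linear _ -> _})
  (quot_proj K).
  apply: quot_ind => x; have /add_subP[s [z [sS1 zK ->]]] := S1K x.
  exists (exist _ s sS1) => /=; apply/eqP.
  by rewrite quot_proj_eq opprD addrA subrr sub0r -scaleN1r rpredZ.
pose phi x := incl (h x).
have phiD x y : phi (x + y) = phi x + phi y by rewrite /phi !linearD.
have phiS x : phi x \in S1 by exact: incl_in.
have phiK x : phi x - x \in K by rewrite -quot_proj_eq; apply/eqP/hK.
pose f : {linear M -> M} := @incl _ _ S1 \o h.
pose fS : submodClosed M := image_sub (f \o @incl _ _ S1).
(* On [S1], f changes elements only by elements of K, hence of T, so f(S1) + T = M and minimality
   applies. *)
have S1f : {subset S1 <= fS}.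
  apply: S1min; last by move=> _ /asboolP[y <-]; apply: phiS.
  split; first by move=> _ /asboolP[y <-]; apply/S1S/phiS.
  move=> x; have /add_subP[s [z [sS1 zT ->]]] := S1T x.
  apply/add_subP; exists (phi s), (z - (phi s - s)); split.
  - by apply/asboolP; exists (exist _ s sS1).
  - by apply: mem_subB => //; apply/KT/phiK.
  - by rewrite opprB addrCA subrKC addrC.
(* The kernel of f lies in K, since f x - x does, and has sum M with [S1], since f(S1) = S1; so
   minimality of K applies. *)
have Kf : {subset K <= preimage_sub f (zero_sub M)}.
  apply: Kmin; last first.
    move=> x; rewrite !inE => /eqP fx0.
    have := phiK x; rewrite -[phi x]/(f x) fx0 sub0r => xK.
    by rewrite -[x]opprK -scaleN1r rpredZ.
  split.
    move=> x; rewrite !inE => /eqP fx0; apply: KT.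
    have := phiK x; rewrite -[phi x]/(f x) fx0 sub0r => xK.
    by rewrite -[x]opprK -scaleN1r rpredZ.
  move=> x; have /asboolP[[s sS1] /= sE] := S1f _ (phiS x).
  apply/add_subP; exists s, (x - s); split; rewrite ?subrKC //.
  by rewrite !inE linearB -[f x]/(phi x) -sE subrr.
have fid s : s \in S1 -> f s = s.
  case/S1f/asboolP => -[t tS1] /= <-; have := Kf _ (phiK t).
  by rewrite !inE linearB subr_eq0 => /eqP.
have [| |S10|K0] := indM S1 K.
- by move=> x xS1 /Kf; rewrite !inE fid // => /eqP.
- by move=> x; have /add_subP := S1K x.
- case: (full_sub_max Tmax) => x.
  by have /add_subP[s [z [/[!S10]/[!inE]/eqP-> zT ->]]] := S1T x; rewrite add0r.
- move=> x; apply: S1S.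
  have /add_subP[s [z [sS1 + ->]]] := S1K x.
  by rewrite K0 inE => /eqP->; rewrite addr0.
Qed.

(** S is generated by e = p(1), and every x in S satisfies x = x e, so it is enough to lift the
    image of e. *)
Lemma summand_projective (S : submodClosed R^o) (p : {linear R^o -> R^o})
    (pS : forall x, p x \in S) (pid : forall x, x \in S -> p x = x) :
  fin_gen (submod S) /\ projective (submod S).
Proof.
pose r : {linear R^o -> submod S} := corestr pS.
have rK x : r (incl x) = x.
  by apply: incl_inj; exact: (pid _ (incl_in x)).
have rE (a : R^o) : r a = (a : R) *: r 1.
  by rewrite -linearZ; congr (r _); apply/esym/mulr1.
split.
  exists 1%N, (fun=> r 1) => x; exists (fun=> incl x).
  by rewrite big_ord1 -rE rK.
move=> X Y g f gsurj; have [x0 x0E] := gsurj (f (r 1)).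
exists (mulr_point x0 \o @incl _ _ S : {linear _ -> _}) => x /=.
by rewrite /mulr_point linearZ x0E -linearZ -rE rK.
Qed.

Variables (n : nat) (P : 'I_n -> lmodType R).
Hypotheses (artR : artinian R^o) (hP : complete_proj_indec P).

(* A direct summand of [R] that is minimal among those not contained in [U]
   would be indecomposable. *)
Lemma proj_indec_generate_ring (U : submodClosed R^o) :
  (forall i (f : {linear P i -> R^o}) x, f x \in U) -> forall a, a \in U.
Proof.
move=> HU a0; apply: contrapT => a0U.
pose Q (S : submodClosed R^o) := ~ {subset S <= U} /\
  exists p : {linear R^o -> R^o},
    (forall x, p x \in S) /\ forall x, x \in S -> p x = x.
have [|S [[SU [p [pS pid]]] Smin]] := artinian_min (Q := Q) artR.
  exists (full_sub R^o : submodClosed R^o); split=> [H|]; first exact/a0U/H.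
  by exists (idfun : {linear R^o -> R^o}).
have [_ _ Pall] := hP.
have [fgS projS] := summand_projective pS pid.
have [|i [f [f' fK f'K]]] := Pall _ fgS projS; last first.
  apply: SU => x xS; have := HU i (@incl _ _ S \o f : {linear _ -> _}).
  by move/(_ (f' (exist _ x xS))); rewrite /= f'K.
(* If [S2] is nonzero, [S1] is a summand of R properly inside S, so minimality of S puts it in U. *)
have split_sub (S1 S2 : submodClosed (submod S)) :
    (forall x, x \in S1 -> x \in S2 -> x = 0) ->
    (forall x, exists y z, [/\ y \in S1, z \in S2 & x = y + z]) ->
    ~ S2 =i zero_sub (submod S) -> forall x, x \in S1 -> incl x \in U.
  move=> S120 S12 S2n0.
  pose T : submodClosed R^o := image_sub (@incl _ _ S \o @incl _ _ S1).
  suff TU : {subset T <= U}.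
    by move=> x xS1; apply: TU; apply/asboolP; exists (exist _ x xS1).
  apply: contrapT => nTU; apply: S2n0 => x.
  apply/idP/idP; last by rewrite inE => /eqP->; rewrite rpred0.
  move=> xS2; rewrite inE; apply/eqP/S120 => //.
  have [q [qS1 qid]] := direct_proj S120 S12.
  have /(_ _ (incl_in x))/asboolP[[y yS1] /incl_inj <-//] : {subset S <= T}.
  apply: Smin; last by move=> _ /asboolP[y <-]; apply: incl_in.
  split=> //; exists (@incl _ _ S \o (q \o corestr pS) : {linear _ -> _}).
  split=> [z|_ /asboolP[[y yS1] <-]] /=.
    by apply/asboolP; exists (exist _ (q (corestr pS z)) (qS1 _)).
  suff -> : corestr pS (incl y) = y by rewrite qid.
  by apply: incl_inj; exact: (pid _ (incl_in y)).
split.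
  apply: contrapT => H; apply: SU => x xS.
  suff -> : x = 0 by rewrite rpred0.
  apply/eqP/negPn/negP => xn0; apply: H; exists (exist _ x xS : submod S).
  by apply: contra xn0 => /eqP/(congr1 (@incl _ _ S)) E; apply/eqP; exact: E.
move=> S1 S2 S120 S12; apply: contrapT => /not_orP[S1n0 S2n0].
apply: SU => x xS.
have [y [z [yS1 zS2 xE]]] := S12 (exist _ x xS : submod S).
have -> : x = incl y + incl z by rewrite -linearD -xE.
apply: rpredD; first exact: (split_sub S1 S2).
apply: (split_sub S2 S1) => // [t ? ?|t]; first exact: S120.
by have [u [v [? ? ->]]] := S12 t; exists v, u; rewrite addrC.
Qed.

(** Pulling U back along a |-> a x reduces the claim to the ring. *)
Lemma proj_indec_generate M (U : submodClosed M) :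
  (forall i (f : {linear P i -> M}) x, f x \in U) -> forall x, x \in U.
Proof.
move=> HU x; rewrite -[x]mulr_point1.
apply: (@proj_indec_generate_ring (preimage_sub (mulr_point x) U)) => i f y.
exact: (HU i (mulr_point x \o f : {linear _ -> _})).
Qed.

End ProjectiveIndecomposable.

(** * Direct sums and the functor Hom(G, _) *)

Section DirectSumMaps.
Variables (R : pzRingType) (I : finType) (V : I -> lmodType R).

Definition dinj i (v : V i) : dirsum V :=
  [ffun j => dfwith (fun k => 0 : V k) v j].
Definition dproj i (f : dirsum V) : V i := f i.

Lemma dinjK i : cancel (@dinj i) (@dproj i).
Proof. by move=> v; rewrite /dproj ffunE dfwith_in. Qed.

Fact dinj_linear i : linear (@dinj i).
Proof.
move=> a v w; apply/ffunP => j; rewrite !ffunE.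
have [ij|ij] := eqVneq i j; first by subst j; rewrite !dfwith_in.
by rewrite !dfwith_out // scaler0 addr0.
Qed.

HB.instance Definition _ i := GRing.isLinear.Build R (V i) (dirsum V) _
  (@dinj i) (@dinj_linear i).

Fact dproj_linear i : linear (@dproj i).
Proof. by move=> a f g; rewrite /dproj !ffunE. Qed.

HB.instance Definition _ i := GRing.isLinear.Build R (dirsum V) (V i) _
  (@dproj i) (@dproj_linear i).

Lemma dirsum_sum f : f = \sum_i dinj (dproj i f).
Proof.
apply/ffunP => j; rewrite -[RHS]/(dproj j _) linear_sum (bigD1 j) //= dinjK.
rewrite big1 ?addr0 // => i ij.
by rewrite /dproj ffunE dfwith_out.
Qed.

End DirectSumMaps.

Section HomMaps.
Variables (R : pzRingType) (G : lmodType R).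

Definition hom_post (X Y : lmodType R) (g : {linear X -> Y})
  (h : LinHom G X) : LinHom G Y := g \o hom_fun h : {linear G -> Y}.

Fact hom_post_linear (X Y : lmodType R) (g : {linear X -> Y}) :
  linear (hom_post g : LinHom G X -> LinHom G Y).
Proof. by move=> a f h; apply: homP => x; apply: (linearD g). Qed.

HB.instance Definition _ (X Y : lmodType R) (g : {linear X -> Y}) :=
  GRing.isLinear.Build (Endo G)^c
  (LinHom G X) (LinHom G Y) _ (@hom_post X Y g) (hom_post_linear g).

Lemma hom_sumE (X : lmodType R) (I : finType) (F : I -> LinHom G X) x :
  (\sum_i F i : LinHom G X) x = \sum_i F i x.
Proof. exact: (big_morph (fun f : LinHom G X => f x)). Qed.

Lemma hom_subP (X : lmodType R) (S : submodClosed X) (f : LinHom G X) :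
  reflect (forall x, f x \in S) (f \in hom_sub G S).
Proof. exact: asboolP. Qed.

End HomMaps.

(** * Radical and socle layers under homomorphisms *)

Section RadicalLayers.
Variables (R : pzRingType) (artR : artinian R^o).
Implicit Types M N : lmodType R.

Lemma rad_sub_mono M (S T : submodClosed M) :
  {subset S <= T} -> {subset rad_sub S <= rad_sub T}.
Proof.
move=> ST; apply/(rad_subP artR) => x /ST xT; apply/colonP => a aJ.
exact: jac_scale.
Qed.

Lemma linear_rad M N (f : {linear M -> N}) x :
  x \in rad_sub (full_sub M) -> f x \in rad_sub (full_sub N).
Proof.
suff /(_ x) : {subset rad_sub (full_sub M) <=
    preimage_sub f (rad_sub (full_sub N))} by [].
apply/(rad_subP artR) => y _; rewrite -colon_preim.
by apply/colonP => a aJ; apply: jac_scale.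
Qed.

Lemma radn_decr M i j : (i <= j)%N -> {subset radn M j <= radn M i}.
Proof.
by move/subnK <-; elim: (j - i)%N => [//|d IHd] x /andP[/IHd].
Qed.

Lemma quot_radn_colonn M j (v : quotmod (radn M j)) :
  v \in colonn j (zero_sub _).
Proof.
elim/quot_ind: v => x; rewrite colonn_preim.
have H : {subset radn M j <= preimage_sub (quot_proj (radn M j)) (zero_sub _)}.
  by move=> y; rewrite !inE /= quot_proj_eq0.
by apply/(radn_le artR) : x.
Qed.

Lemma linear_colonn j M N (f : {linear M -> N}) x :
  x \in colonn j (zero_sub M) -> f x \in colonn j (zero_sub N).
Proof.
rewrite colonn_preim; apply: colonn_le => y; rewrite !inE => /eqP->.
by rewrite linear0.
Qed.

Lemma rad_kernel j M N (f : {linear M -> N}) x :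
  (forall y, f y \in colonn j.+1 (zero_sub N)) ->
  x \in rad_sub (full_sub M) -> f x \in colonn j (zero_sub N).
Proof.
move=> H; suff /(_ x) : {subset rad_sub (full_sub M) <=
  preimage_sub f (colonn j (zero_sub N))} by [].
by apply/(rad_subP artR) => y _; rewrite -colon_preim; apply: H.
Qed.

Lemma radn_kernel j M N (f : {linear M -> N}) x :
  (forall y, f y \in colonn j (zero_sub N)) -> x \in radn M j -> f x = 0.
Proof.
move=> H xj; apply/eqP; suff /(_ x xj) : {subset radn M j <=
  preimage_sub f (zero_sub N)} by [].
by apply/(radn_le artR) => y; rewrite -colonn_preim.
Qed.

(** Both sides say that (0 : J^j) is all of M. *)
Lemma radn_eq0 j M : radn M j =i zero_sub M <-> forall x, x \in socn j M.
Proof.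
split=> [H x|H].
  rewrite (socn_colonn artR); move: x; apply/(radn_le artR) => x.
  by rewrite H.
have /(radn_le artR) H0 : forall x, x \in colonn j (zero_sub M).
  by move=> x; rewrite -(socn_colonn artR).
by move=> x; apply/idP/idP => [/H0//|]; rewrite inE => /eqP->; rewrite rpred0.
Qed.

End RadicalLayers.

(** * The ADR algebra and its standard modules *)

Section ADRAlgebra.
Variables (A : pzRingType) (artA : artinian A^o).
Variables (n : nat) (P : 'I_n -> lmodType A) (hP : complete_proj_indec P).
Variables (l : 'I_n -> nat) (hl : forall i, loewy_length (P i) (l i)).
Implicit Types x y : adr_index l.

Local Notation G := (adr_gen P l).

Lemma proj_artinian i : artinian (P i).
Proof. by have [Pi _ _] := hP; apply: fin_gen_artinian => //; case: (Pi i). Qed.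

(* Reducing to a smaller index: a map from [P_i / Rad^j P_i] to a module of
   Loewy length at most [c < j] factors through [P_i / Rad^c P_i]. *)
Lemma adr_factor c (N : lmodType A) (U : submodClosed (adr_hom P l N)) :
  (forall y (g : {linear adr_summand P y -> N}) (h : adr_proj P y),
     (tagged y < c)%N -> (forall z, g z \in colonn c (zero_sub N)) ->
     hom_post g h \in U) ->
  forall f : adr_hom P l N, (forall z, f z \in colonn c (zero_sub N)) ->
  f \in U.
Proof.
move=> HU f fN.
pose fy y : {linear adr_summand P y -> N} := hom_fun f \o @dinj _ _ _ y.
pose py y : adr_proj P y := @dproj _ _ _ y : {linear _ -> _}.
have -> : f = \sum_y hom_post (fy y) (py y).
  apply: homP => z; rewrite hom_sumE [in LHS](dirsum_sum z).
  by rewrite (linear_sum (hom_fun f)).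
apply: rpred_sum => y _; have [yc|cy] := ltnP (tagged y) c.
  by apply: HU => // z; apply: fN.
case: c => [|c] in HU fN cy *.
  suff -> : hom_post (fy y) (py y) = 0 by rewrite rpred0.
  by apply: homP => z; have := fN (dinj (dproj y z)); rewrite inE => /eqP.
have cl : (c < l (tag y))%N by apply: ltn_trans cy _; apply: ltn_ord.
(* The bound is now [c.+1]; the zero-based index c stands for the quotient by Rad^(c+1). *)
pose y' : adr_index l := Tagged (fun i => 'I_(l i)) (Ordinal cl).
pose pi0 := quot_proj (radn (P (tag y)) (tagged y).+1).
have ker0 z : z \in radn (P (tag y)) c.+1 -> (fy y \o pi0) z = 0.
  by apply: (radn_kernel artA) => w; apply: fN.
pose g : {linear adr_summand P y' -> N} := quot_lift ker0.
have ker1 z : z \in radn (P (tag y)) (tagged y).+1 ->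
    quot_proj (radn (P (tag y)) c.+1) z = 0.
  move=> zr; apply/eqP; rewrite quot_proj_eq0.
  exact: radn_decr (leqW cy) _ zr.
pose r : {linear adr_summand P y -> adr_summand P y'} := quot_lift ker1.
have -> : hom_post (fy y) (py y) = hom_post g (hom_post r (py y)).
  apply: homP => z /=; elim/quot_ind: (dproj y z) => p.
  by rewrite (quot_liftE ker1) (quot_liftE ker0).
apply: HU => //; apply: quot_ind => z.
by rewrite [g _](quot_liftE ker0); apply: fN.
Qed.

(* Yoneda: [adr_proj P y] is generated by the projection of [G] onto its
   summand [y]. *)
Lemma adr_proj_hom y (N : lmodType A)
    (chi : {linear adr_proj P y -> adr_hom P l N}) :
  exists g : {linear adr_summand P y -> N}, forall h, chi h = hom_post g h.
Proof.
pose p : adr_proj P y := @dproj _ _ _ y : {linear _ -> _}.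
exists (hom_fun (chi p) \o @dinj _ _ _ y : {linear _ -> _}) => h.
(* Scalars act by precomposition, so e carries p to h and [chi h] is determined by [chi p]. *)
pose e : Endo G := @dinj _ _ (adr_summand P (l := l)) y \o hom_fun h
  : {linear _ -> _}.
have {1}-> : h = (e : adr_algebra P l) *: p.
  by apply: homP => z /=; rewrite dinjK.
by rewrite linearZ; apply: homP.
Qed.

(** Otherwise a lift of g to the projectives is onto, hence splits and is bijective, so both indices
    have the same first coordinate i. Then P_i/Rad^(b+1) maps onto P_i/Rad^(a+1) with b < a < l_i,
    and the radical series stalls before reaching zero. *)
Lemma adr_summand_map_rad x y
    (g : {linear adr_summand P y -> adr_summand P x}) :
  ~~ adr_le y x -> forall z, g z \in rad_sub (full_sub (adr_summand P x)).
Proof.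
rewrite negb_or -leqNgt => /andP[yx lyx] z0; apply: contrapT => gz0.
have [Pind Pirr _] := hP.
have [fgx projx indx] := Pind (tag x); have [fgy projy indy] := Pind (tag y).
pose pix := quot_proj (radn (P (tag x)) (tagged x).+1).
pose piy := quot_proj (radn (P (tag y)) (tagged y).+1).
have [|h hE] := projy _ _ pix (g \o piy : {linear _ -> _}).
  by apply: quot_ind => w; exists w.
(* An image of h inside the radical would force [g z0] into the radical. *)
have hsurj w : exists v, h v = w.
  suff /(_ w)/asboolP : forall w, w \in image_sub h by [].
  apply: proj_indec_local => //; first exact: proj_artinian.
  move=> H; apply: gz0; elim/quot_ind: z0 => p.
  rewrite -[g _]/((g \o piy) p) -hE; apply: (linear_rad artA).
  by apply: H; apply/asboolP; exists p.
have [s sE] := projx _ _ h (idfun : {linear _ -> _}) hsurj.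
have iso : isomorphic (P (tag y)) (P (tag x)).
  have [| |im0|ker0] := indy.2 (image_sub s) (preimage_sub h (zero_sub _)).
  - by move=> _ /asboolP[w <-]; rewrite !inE sE => /eqP/= ->; rewrite linear0.
  - move=> v; exists (s (h v)), (v - s (h v)); split; last by rewrite subrKC.
      by apply/asboolP; exists (h v).
    by rewrite !inE linearB sE subrr.
  - have [[w wn0] _] := indx; case/negP: wn0.
    have : s w \in image_sub s by apply/asboolP; exists w.
    by rewrite im0 inE => /eqP sw0; rewrite -[w]/(idfun w) -sE sw0 linear0.
  - exists h, s => // v; apply/eqP; rewrite -subr_eq0.
    suff : s (h v) - v \in zero_sub (P (tag y)) by [].
    by rewrite -ker0 !inE linearB sE subrr.
(* Opening the pairs lets the equality of first coordinates be substituted into the types of the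
   maps. *)
case: x y g yx lyx z0 gz0 fgx projx indx fgy projy indy @pix @piy h hE hsurj s
  sE iso => [i a] [j b] g yx lyx _ _ _ _ _ _ _ _ pix piy h hE hsurj _ _.
rewrite /= in g yx lyx pix piy h hE hsurj *.
move=> /Pirr ji; subst j.
have ba : (b < a)%N.
  by rewrite ltn_neqAle lyx andbT; apply: contra yx => /eqP/val_inj->.
have rb : {subset radn (P i) b.+1 <= radn (P i) a.+1}.
  apply/(radn_le artA) => p.
  have : pix p \in colonn b.+1 (zero_sub _).
    have [q <-] := hsurj p; have -> : pix (h q) = g (piy q) := hE q.
    by apply: linear_colonn; apply: quot_radn_colonn.
  rewrite colonn_preim; apply: colonn_le => w.
  by rewrite !inE quot_proj_eq0.
have rb1 : {subset radn (P i) b.+1 <= radn (P i) b.+2}.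
  by move=> p /rb; apply: radn_decr; rewrite ltnS.
have rd d : {subset radn (P i) b.+1 <= radn (P i) (d + b.+1)}.
  elim: d => [//|d IHd] p /rb1; rewrite addSn.
  exact: (rad_sub_mono artA).
have [ln lmin] := hl i.
suff : (l i <= b.+1)%N by rewrite leqNgt (leq_ltn_trans ba (ltn_ord a)).
apply: lmin => p; apply/idP/idP; last by rewrite inE => /eqP->; rewrite rpred0.
move/(rd (l i)); rewrite -ln; apply: radn_decr; exact: leq_addr.
Qed.

(** The submodule divided out in [adr_std]. *)
Definition adr_trace x : submodClosed (adr_proj P x) :=
  trace (fun _ : unit =>
    dirsum (fun y : {y : adr_index l | ~~ adr_le y x} => adr_proj P (val y)))
    (adr_proj P x).

(** One inclusion is [adr_summand_map_rad]. Conversely, the radical of the summand x is short enough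
    for [adr_factor] to pass through summands with smaller second coordinate, which occur in the
    trace. *)
Lemma adr_traceE x :
  adr_trace x =i hom_sub G (rad_sub (full_sub (adr_summand P x))).
Proof.
move=> f; apply/idP/idP.
  move: f; apply: sum_sub_le => -[u psi] /= _ /asboolP[v <-].
  rewrite (dirsum_sum v) linear_sum; apply: rpred_sum => y _.
  pose V (y : {y : adr_index l | ~~ adr_le y x}) := adr_proj P (val y).
  pose iy : {linear V y -> dirsum V} :=
    @dinj (adr_algebra P l) _ V y.
  have [g gE] := adr_proj_hom (psi \o iy : {linear _ -> _}).
  rewrite -[psi _]/((psi \o iy) _) gE.
  by apply/hom_subP => z; apply: adr_summand_map_rad; apply: (valP y).
move/hom_subP => fr; apply: (adr_factor (c := tagged x)) => [y g h yx _|z].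
  have yx' : ~~ adr_le y x.
    rewrite negb_or -leqNgt (ltnW yx) andbT.
    by apply: contraTneq yx => ->; rewrite ltnn.
  pose V (y : {y : adr_index l | ~~ adr_le y x}) := adr_proj P (val y).
  pose py : {linear dirsum V -> V (exist _ y yx')} :=
    @dproj (adr_algebra P l) _ V (exist _ y yx').
  pose psi : {linear dirsum V -> adr_proj P x} := hom_post g \o py.
  apply: (@sum_sub_ge _ _ _ _
    (existT (fun=> {linear dirsum V -> adr_proj P x}) tt psi)).
  apply/asboolP; exists (@dinj (adr_algebra P l) _ V (exist _ y yx') h) => /=.
  by rewrite dinjK.
(* The summand is killed by J^(tagged x + 1), so its radical is killed by J^(tagged x). *)
have H := quot_radn_colonn artA.
exact: (rad_kernel artA (f := idfun) (fun v => H _ _ v)).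
Qed.

(** P_i is the summand P_i/Rad^(l_i) P_i, of zero-based index l_i - 1; l_i is positive as P_i is
    nonzero. *)
Lemma adr_gen_proj i :
  exists f : {linear G -> P i}, forall p, exists z, f z = p.
Proof.
have [Pind _ _] := hP; have [_ _ [[w wn0] _]] := Pind i.
have [l0 lmin] := hl i.
have lgt0 : (0 < l i)%N.
  rewrite lt0n; apply/eqP => li0; have := l0 w.
  by rewrite li0 !inE (negbTE wn0).
have ll : ((l i).-1 < l i)%N by rewrite prednK.
pose x : adr_index l := Tagged (fun i => 'I_(l i)) (Ordinal ll).
have ker p : p \in radn (P i) (l i).-1.+1 -> (idfun : {linear _ -> P i}) p = 0.
  by rewrite prednK // l0 inE => /eqP.
pose g : {linear adr_summand P x -> P i} := quot_lift ker.
exists (g \o @dproj _ _ _ x : {linear _ -> _}) => p.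
exists (dinj (i := x) (quot_proj _ p)).
by rewrite /= dinjK (quot_liftE ker).
Qed.

Lemma adr_gen_generate (N : lmodType A) (U : submodClosed N) :
  (forall (f : {linear G -> N}) z, f z \in U) -> forall v, v \in U.
Proof.
move=> HU; apply: (proj_indec_generate artA hP) => i f p.
have [g gsurj] := adr_gen_proj i; have [z <-] := gsurj p.
exact: (HU (f \o g : {linear _ -> _})).
Qed.

Lemma adr_std_hom_soc y (N : lmodType A)
    (chi : {linear adr_std P y -> adr_hom P l N}) h :
  chi h \in hom_sub G (soc N).
Proof.
elim/quot_ind: h => h.
have [g gE] := adr_proj_hom (chi \o quot_proj (adr_trace y) : {linear _ -> _}).
rewrite -[chi _]/((chi \o quot_proj (adr_trace y)) h) gE.
apply/hom_subP => z; rewrite (soc_colon artA) -[hom_post _ _ _]/(g (h z)).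
(* G generates the radical, viewed as a module, and maps from G into it lie in the trace, which chi
   kills. *)
have grad : {subset rad_sub (full_sub (adr_summand P y)) <=
    preimage_sub g (zero_sub N)}.
  pose I := @incl _ _ (rad_sub (full_sub (adr_summand P y))).
  suff H : forall v, v \in preimage_sub (g \o I) (zero_sub N).
    by move=> v vr; apply: (H (exist _ v vr)).
  apply: adr_gen_generate => f w.
  pose h' : adr_proj P y := I \o f : {linear _ -> _}.
  have : hom_post g h' = 0.
    rewrite -gE /= -[RHS](linear0 chi); congr (chi _); apply/eqP.
    rewrite quot_proj_eq0 adr_traceE; apply/hom_subP => u; exact: incl_in.
  by move/(congr1 (fun k : LinHom G N => k w)) => E; rewrite !inE; apply/eqP.
by rewrite colon_preim; apply: (rad_sub_le grad).
Qed.

(** * The Delta-semisimple filtration of Hom(G, N) *)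

Lemma deltan_hom m (N : lmodType A) :
  deltan m (adr_hom P l N) =i hom_sub G (socn m N).
Proof.
elim: m => [|m IHm] f.
  apply/idP/hom_subP => [|H].
    by rewrite inE => /eqP-> z; rewrite inE.
  by rewrite inE; apply/eqP/homP => z; have := H z; rewrite inE => /eqP.
pose D := deltan m (adr_hom P l N).
apply/idP/idP => [fD|/hom_subP fS].
  (* The map [psi] induced by q carries delta of the quotient by D into Hom(G, Soc(N/Soc_m N)). *)
  pose q := quot_proj (socn m N).
  have ker d : d \in D -> (hom_post q : {linear adr_hom P l N -> _}) d = 0.
    rewrite IHm => /hom_subP dS; apply: homP => z.
    by apply/eqP; rewrite quot_proj_eq0.
  pose psi : {linear quotmod D -> adr_hom P l _} := quot_lift ker.
  have dS : {subset delta (quotmod D) <=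
      preimage_sub psi (hom_sub G (soc (quotmod (socn m N))))}.
    apply: sum_sub_le => -[y phi] /= _ /asboolP[h <-].
    exact: (adr_std_hom_soc (psi \o phi : {linear _ -> _})).
  have := dS _ fD; rewrite inE /= (quot_liftE ker) => /hom_subP H.
  by apply/hom_subP => z; apply: H.
have {}fS z : f z \in colonn m.+1 (zero_sub N).
  by rewrite -(socn_colonn artA).
(* It remains to treat maps through one summand y, where g takes the radical into Soc_m N. *)
move: f fS; apply: adr_factor => y g h _ gS.
have ker t : t \in adr_trace y ->
    (quot_proj D \o hom_post g : {linear adr_proj P y -> _}) t = 0.
  rewrite adr_traceE => /hom_subP tr; apply/eqP.
  rewrite quot_proj_eq0 IHm; apply/hom_subP => z.
  by rewrite (socn_colonn artA); apply: (rad_kernel artA gS).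
pose phi : {linear adr_std P y -> quotmod D} := quot_lift ker.
suff : quot_proj D (hom_post g h) \in delta (quotmod D) by [].
apply: (@sum_sub_ge _ _ _ _ (Tagged (fun y => {linear adr_std P y -> _}) phi)).
apply/asboolP; exists (quot_proj (adr_trace y) h).
by rewrite /= (quot_liftE ker).
Qed.

(** As G is a generator, Hom(G, Soc_m N) is everything only if Soc_m N = N. *)
Lemma deltan_full m (N : lmodType A) :
  deltan m (adr_hom P l N) =i full_sub _ <-> radn N m =i zero_sub N.
Proof.
rewrite (radn_eq0 artA); split=> [H|H f].
  apply: adr_gen_generate => f z.
  by have := H f; rewrite deltan_hom [RHS]inE => /hom_subP.
by rewrite deltan_hom [RHS]inE; apply/hom_subP.
Qed.

(** N is generated by images of the P_i, which are killed by J^t for t the maximum of the l_i. *)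
Lemma loewy_length_exists (N : lmodType A) : exists t, loewy_length N t.
Proof.
pose p t := `[< radn N t =i zero_sub N >].
have exp : exists t, p t.
  exists (\max_i l i); apply/asboolP/(radn_eq0 artA) => z.
  rewrite (socn_colonn artA); move: z.
  apply: (proj_indec_generate artA hP) => i f z; apply: linear_colonn.
  apply: (colonn_mono (i := l i)); first exact: leq_bigmax.
  rewrite -(socn_colonn artA); move: z; apply/(radn_eq0 artA).
  by have [] := hl i.
case: (ex_minnP exp) => t /asboolP pt tmin; exists t; split=> // j.
by move/asboolP/tmin.
Qed.

End ADRAlgebra.

Theorem theorem4p4 (k : comPzRingType) (A : algType k) (hA : artin_algebra A)
    (n : nat) (P : 'I_n -> lmodType A) (hP : complete_proj_indec P)
    (l : 'I_n -> nat) (hl : forall i, loewy_length (P i) (l i))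
    (M : lmodType A) (hM : fin_gen M) :
  (forall m : nat,
     deltan m (adr_hom P l M) =i hom_sub (adr_gen P l) (socn m M)) /\
  (exists t : nat, loewy_length M t /\ delta_ssl (adr_hom P l M) t).
Proof.
have artA := artin_algebra_artinian hA; split.
  by move=> m; apply: deltan_hom.
have [t [rt tmin]] := loewy_length_exists artA hP hl M.
exists t; split; first by split.
split; first exact/deltan_full.
by move=> m /deltan_full H; apply: tmin; apply: H.
Qed.
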